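(* For $f\in C(\mathbb{R};\mathbb{R})$ satisfying $xf(x)>0$ for all $x\ne0$, $f(0)=0$, $\lim_{x\to-\infty}f(x)=-\infty$ and $\lim_{x\to\infty}f(x)=\infty$, let $$\overline{x}(f,y)=2y+\max\left(f^+(y),-f^-(-y)\right),\quad y\ge0,$$ where $f^{+}(x)=\sup\{z>0:f(z)=x\}$ for $x>0$, $f^-(x)=\inf\{z<0:f(z)=x\}$ for $x<0$, and $f^+(0)=f^-(0)=0$. Then: (i) For each such $f$, the function $y\mapsto\overline{x}(f,y)$ is increasing, $\lim_{y\to\infty}\overline{x}(f,y)=+\infty$ and $\lim_{y\to0^+}\overline{x}(f,y)=0$. (ii) If $f_1,f_2\in C(\mathbb{R};\mathbb{R})$ are two functions such that, for each $i\in\{1,2\}$, $xf_i(x)>0$ for all $x\ne0$, $f_i(0)=0$, $\lim_{x\to-\infty}f_i(x)=-\infty$ and $\lim_{x\to\infty}f_i(x)=\infty$, and $|f_2(x)|\ge|f_1(x)|$ for all $x\in\mathbb{R}$, then $\overline{x}(f_1,y)\ge\overline{x}(f_2,y)$ for all $y\geq 0$.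
   Context: $f^+(x)=\sup\{z>0:f(z)=x\}$ for $x\ge0$ and $f^-(x)=\inf\{z<0:f(z)=x\}$ for $x\le0$, with the convention $f^+(0)=f^-(0)=0$. *)

(* Defs.v *)
From HB Require Import structures.
From mathcomp Require Import all_boot all_order all_algebra.
From mathcomp Require Import all_classical all_reals all_analysis.

Set Implicit Arguments.
Unset Strict Implicit.
Unset Printing Implicit Defensive.

Import Order.TTheory GRing.Theory Num.Theory.
Import numFieldNormedType.Exports.

Local Open Scope classical_set_scope.
Local Open Scope ring_scope.

Record admissible (R : realType) (f : R -> R) : Prop := Admissible {
  admissible_continuous : continuous f;
  admissible_sign : forall x : R, x != 0 -> 0 < x * f x;
  admissible_at0 : f 0 = 0;
  admissible_cvgNy : f x @[x --> -oo] --> -oo;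
  admissible_cvgy : f x @[x --> +oo] --> +oo
}.

(* The suprema and infima below are real-valued; the library returns 0 on sets
   that are empty or unbounded on the relevant side.  For admissible f this
   default never occurs: fplus is only used at x >= 0 and fminus at x <= 0,
   where for x != 0 the sets are nonempty and bounded. *)

Definition fplus (R : realType) (f : R -> R) (x : R) : R :=
  if x == 0 then 0 else sup [set z : R | 0 < z /\ f z = x].

Definition fminus (R : realType) (f : R -> R) (x : R) : R :=
  if x == 0 then 0 else inf [set z : R | z < 0 /\ f z = x].

Definition xbar (R : realType) (f : R -> R) (y : R) : R :=
  2 * y + Num.max (fplus f y) (- fminus f (- y)).

(* Main.v *)
Require Import Defs.
From HB Require Import structures.
From mathcomp Require Import all_boot all_order all_algebra.
From mathcomp Require Import all_classical all_reals all_analysis.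

Set Implicit Arguments.
Unset Strict Implicit.
Unset Printing Implicit Defensive.

Import Order.TTheory GRing.Theory Num.Theory.
Import numFieldNormedType.Exports.

Local Open Scope classical_set_scope.
Local Open Scope ring_scope.

(* For y >= 0 the number f^+(y) is characterized by f(f^+(y)) = y and f > y on
   (f^+(y), +oo), by continuity and the intermediate value theorem.  Strict
   monotonicity in y and antitonicity in f follow by evaluating f at f^+; the
   limit at 0 follows because f is bounded away from 0 on [e, +oo).  The
   negative side reduces to the positive one through
   -f^-(-y) = g^+(y) with g(x) = -f(-x). *)

Section Fplus.
Variables (R : realType) (f : R -> R).
Hypothesis f_adm : admissible f.

Lemma admissible_gt0 (x : R) : 0 < x -> 0 < f x.
Proof.
by move=> x_gt0; rewrite -(pmulr_rgt0 _ x_gt0) admissible_sign// gt_eqF.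
Qed.

Lemma admissible_eventually_gt (y : R) :
  exists2 M : R, 0 < M & forall z, M < z -> y < f z.
Proof.
have [M [_ fM]] := cvgry_gt (admissible_cvgy f_adm) y.
exists (Num.max 1 M); first by rewrite lt_max ltr01.
by move=> z; rewrite gt_max => /andP[_ Mz]; exact: fM.
Qed.

(** Since [f] eventually exceeds [y], the intermediate value theorem applies on [[a, a + M + 1]],
    whose right end lies beyond [M]. Taking [a = 0] shows that solutions exist; a larger [a] yields
    solutions arbitrarily far to the right. *)
Lemma admissible_solution (a y : R) : 0 <= a -> f a <= y ->
  exists2 z, a <= z & f z = y.
Proof.
move=> a_ge0 fay; have [M M_gt0 fM] := admissible_eventually_gt y.
have le_aM : a <= a + M + 1 by rewrite -addrA lerDl addr_ge0// ltW.
have yfM : y <= f (a + M + 1).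
  by apply/ltW/fM; rewrite addrAC addrC ltrDl ltr_wpDl.
have [||z] := @IVT _ f a (a + M + 1) y le_aM.
- exact/continuous_subspaceT/admissible_continuous.
- by rewrite ge_min fay le_max yfM orbT.
by rewrite in_itv/= => /andP[az _] fzy; exists z.
Qed.

Lemma fplus_spec (y : R) : 0 <= y ->
  [/\ 0 <= fplus f y, f (fplus f y) = y & forall z, fplus f y < z -> y < f z].
Proof.
rewrite le_eqVlt /fplus => /predU1P[<-|y_gt0].
  by rewrite eqxx; split=> //; [exact: admissible_at0|exact: admissible_gt0].
rewrite gt_eqF//; set S := [set z | _].
(* A solution that is merely nonnegative is positive, because [f 0 = 0 < y]. *)
have solS a z : 0 <= a -> a <= z -> f z = y -> S z.
  move=> a_ge0 az fzy; split=> //; rewrite lt_neqAle (le_trans a_ge0 az) andbT.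
  apply/eqP => z0; move: y_gt0.
  by rewrite -fzy -z0 (admissible_at0 f_adm) ltxx.
have S0 : S !=set0.
  have [|z z_ge0 fzy] := @admissible_solution 0 y (lexx 0).
    by rewrite (admissible_at0 f_adm) ltW.
  by exists z; apply: (solS 0).
have ubS : has_ubound S.
  have [M _ fM] := admissible_eventually_gt y; exists M => z [_ fzy].
  by rewrite leNgt; apply/negP => /fM; rewrite fzy ltxx.
have sup_ge0 : 0 <= sup S.
  by have [z Sz] := S0; rewrite (le_trans (ltW Sz.1))//; exact: ub_le_sup.
split=> //.
(* The supremum is attained: it is a limit of points of [S], and the level set of a continuous
   function is closed. *)
- have closed_fy : closed (f @^-1` [set x | x = y]).
    have /continuous_closedP := admissible_continuous f_adm; apply.
    exact: closed_eq.
  suff : closure (f @^-1` [set x | x = y]) (sup S).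
    by rewrite -(closure_id _).1.
  apply: (@closure_subset _ S); first by move=> z [].
  exact: closure_sup.
(* If [f z <= y] beyond [sup S], then [f] would have to reach [y] again to the right of [z], giving
   an element of [S] above its supremum. *)
- move=> z ltz; rewrite ltNge; apply/negP => fzy.
  have z_ge0 : 0 <= z by rewrite (le_trans sup_ge0)// ltW.
  have [c zc fcy] := admissible_solution z_ge0 fzy.
  have := ub_le_sup ubS (solS _ _ z_ge0 zc fcy).
  by rewrite leNgt (lt_le_trans ltz zc).
Qed.

Lemma fplus_lt (y1 y2 : R) : 0 <= y1 -> y1 < y2 -> fplus f y1 < fplus f y2.
Proof.
move=> y1_ge0 lt_y; have y2_ge0 := le_trans y1_ge0 (ltW lt_y).
have [_ fy1 _] := fplus_spec y1_ge0; have [_ fy2 above2] := fplus_spec y2_ge0.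
rewrite ltNge le_eqVlt; apply/negP => /predU1P[eqp|/above2].
  by move: lt_y; rewrite -fy1 -fy2 eqp ltxx.
by rewrite fy1 ltNge (ltW lt_y).
Qed.

Lemma fplus_cvg0 : fplus f y @[y --> 0^'+] --> (0 : R).
Proof.
apply/cvgrPdist_lt => e e_gt0.
(* The level 1 is an arbitrary positive threshold: it confines [fplus f y] to a bounded range for
   [y <= 1], so a minimum over the compact [[e, e + M]] suffices. *)
have [M M_gt0 fM] := admissible_eventually_gt 1.
have leM : e <= e + M by rewrite lerDl ltW.
have [|c] := @EVT_min _ f e (e + M) leM.
  exact/continuous_subspaceT/admissible_continuous.
rewrite in_itv/= => /andP[ec _] fc_min.
have fc_gt0 : 0 < f c by apply: admissible_gt0; exact: lt_le_trans ec.
near=> y.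
have y_ge0 : 0 <= y by near: y; exact: nbhs_right_ge.
have [p_ge0 fpy _] := fplus_spec y_ge0.
rewrite sub0r normrN ger0_norm// ltNge; apply/negP => ep.
(* If [e <= fplus f y], then either [f c <= y] or [1 < y]; both fail for [y] close to 0. *)
have [pM|] := leP (fplus f y) (e + M).
  have := fc_min (fplus f y); rewrite in_itv/= ep pM fpy => /(_ isT).
  by rewrite leNgt => /negP; apply; near: y; exact: nbhs_right_lt.
move=> lt_p; have : 1 < y.
  by rewrite -fpy; apply/fM/(lt_trans _ lt_p); rewrite ltrDr.
by apply/negP; rewrite -leNgt; near: y; exact: nbhs_right_le.
Unshelve. all: by end_near. Qed.

End Fplus.

(** The graph of [f] turned by a half-turn about the origin, which exchanges the two half-lines and
    the two limits at infinity. *)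
Definition odd_conj (R : realType) (f : R -> R) (x : R) : R := - f (- x).

Lemma admissible_odd_conj (R : realType) (f : R -> R) :
  admissible f -> admissible (odd_conj f).
Proof.
case=> f_cont f_sign f0 fNy fy; split.
- move=> x; apply: cvgN.
  by apply: (@continuous_comp _ _ _ -%R f); [exact: oppr_continuous|exact: f_cont].
- by move=> x x0; rewrite mulrN -mulNr f_sign// oppr_eq0.
- by rewrite /odd_conj oppr0 f0 oppr0.
- apply/cvgNrNy; apply: (@cvg_comp _ _ _ -%R f _ +oo) fy.
  by rewrite ninftyN.
- apply/cvgNry; apply: (@cvg_comp _ _ _ -%R f _ -oo) fNy.
  by rewrite ninfty.
Qed.

Lemma fminusN (R : realType) (f : R -> R) (y : R) :
  - fminus f (- y) = fplus (odd_conj f) y.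
Proof.
rewrite /fminus /fplus oppr_eq0; case: ifP => _; first by rewrite oppr0.
(* [inf] unfolds to minus the [sup] of the negated set, so only an equality of sets remains. *)
rewrite /inf opprK; congr sup; apply/seteqP; split => [_ [z [z_lt0 fz] <-]|z [z_gt0 fz]].
  by rewrite /= /odd_conj opprK fz opprK oppr_gt0.
by exists (- z); rewrite ?opprK//= oppr_lt0 -fz /odd_conj opprK.
Qed.

Lemma xbarE (R : realType) (f : R -> R) (y : R) :
  xbar f y = 2 * y + Num.max (fplus f y) (fplus (odd_conj f) y).
Proof. by rewrite /xbar fminusN. Qed.

Lemma fplus_le (R : realType) (f1 f2 : R -> R) (y : R) :
  admissible f1 -> admissible f2 -> (forall x, `|f1 x| <= `|f2 x|) ->
  0 <= y -> fplus f2 y <= fplus f1 y.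
Proof.
move=> f1_adm f2_adm le_f y_ge0.
have [p1_ge0 _ above1] := fplus_spec f1_adm y_ge0.
have [_ f2p _] := fplus_spec f2_adm y_ge0.
(* Otherwise [f1] exceeds [y] at the point [fplus f2 y], where [f2] equals [y]; both values are
   positive there, so this contradicts [le_f]. *)
rewrite leNgt; apply/negP => lt_p; have p2_gt0 := le_lt_trans p1_ge0 lt_p.
have := le_f (fplus f2 y); rewrite !gtr0_norm; try exact: admissible_gt0.
by rewrite f2p leNgt above1.
Qed.

Theorem proposition7 (R : realType) :
  (forall f : R -> R, admissible f ->
    [/\ (forall y1 y2 : R, 0 <= y1 -> y1 < y2 -> xbar f y1 < xbar f y2),
        xbar f y @[y --> +oo] --> +oo
      & xbar f y @[y --> 0^'+] --> (0 : R)]) /\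
  (forall f1 f2 : R -> R, admissible f1 -> admissible f2 ->
    (forall x : R, `|f1 x| <= `|f2 x|) ->
    forall y : R, 0 <= y -> xbar f2 y <= xbar f1 y).
Proof.
split=> [f f_adm|f1 f2 f1_adm f2_adm le_f y y_ge0].
  have g_adm := admissible_odd_conj f_adm.
  split=> [y1 y2 y1_ge0 lt_y| |].
  - rewrite !xbarE ltrD ?ltr_pM2l// gt_max !lt_max.
    by rewrite (fplus_lt f_adm)// (fplus_lt g_adm)// orbT.
  (* The maximum is nonnegative, so [xbar f y] dominates [2 * y], hence [y]. *)
  - apply: (@ger_cvgy _ _ _ _ id) => //.
    near=> y; have y_ge0 : 0 <= y by near: y; exact: nbhs_pinfty_ge.
    have [p_ge0 _ _] := fplus_spec f_adm y_ge0.
    rewrite xbarE ler_wpDr// ?le_max ?p_ge0//.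
    by rewrite mulr_natl mulr2n lerDl.
  - under eq_fun do rewrite xbarE.
    suff : 2 * y + Num.max (fplus f y) (fplus (odd_conj f) y) @[y --> (0 : R)^'+]
        --> (2 * 0 + Num.max 0 0 : R) by rewrite maxxx mulr0 addr0.
    apply: cvgD.
      by apply: cvgM; [exact: cvg_cst|apply: cvg_at_right_filter; exact: cvg_id].
    apply: (continuous2_cvg _ (@max_continuous _ R (0, 0))).
      exact: fplus_cvg0.
    exact: fplus_cvg0.
have le_g x : `|odd_conj f1 x| <= `|odd_conj f2 x| by rewrite !normrN.
rewrite !xbarE lerD2l ge_max !le_max fplus_le//=.
by rewrite (fplus_le _ _ le_g) ?orbT//; exact: admissible_odd_conj.
Unshelve. all: by end_near. Qed.
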